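(* Let $r\geq 1$, $n\geq r+1$ and $k\geq 0$ be integers. Then $$r\,Q_{n-r,k}(r,t)=\sum_{F\in\mathcal F_{n,k}^r}t^{\mathrm{eld}(F)}.$$
   Context: Define polynomials $Q_m(x,y,z,t)$ by $Q_1=1$ and $Q_{m+1}=[x+mz+(y+t)(m+y\partial_y)]Q_m$ for $m\ge1$, and define $Q_{m,k}(x,t)$ by $Q_m(x,y,1,t)=\sum_{k\ge 0}Q_{m,k}(x,t)y^k$ (so $Q_{m,k}=0$ for $k\geq m$). All trees are rooted trees whose vertices are labeled by distinct positive integers. A vertex $j$ is a descendant of $i$ if the path from the root to $j$ passes through $i$ (every vertex is a descendant of itself); $\beta_T(i)$ is the smallest descendant of $i$. A child of $i$ is a descendant joined to $i$ by an edge $(i,j)$; children of the same vertex are brothers. A plane tree is a rooted tree in which the children of each vertex are linearly ordered (left to right). In a plane tree $T$, a vertex $j$ is elder if it has a brother $k$ to its right with $\beta_T(k)<\beta_T(j)$. An edge $(i,j)$ is proper if $j$ is an elder child of $i$ or $i<\beta_T(j)$; otherwise it is improper. $\mathcal F_{n,k}^r$ is the set of forests consisting of $r$ plane trees whose vertex sets partition $[n]=\{1,\dots,n\}$, whose roots are $1,\dots,r$, and which have exactly $k$ improper edges in total; $\mathrm{eld}(F)$ is the total number of elder vertices in $F$. *)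

(* Defs.v *)
From mathcomp Require Import all_boot all_order all_algebra.
From mathcomp Require Import mpoly.
Set Implicit Arguments. Unset Strict Implicit. Unset Printing Implicit Defensive.
Import GRing.Theory.
Local Open Scope ring_scope.

Definition vx : 'I_4 := @Ordinal 4 0 isT.
Definition vy : 'I_4 := @Ordinal 4 1 isT.
Definition vz : 'I_4 := @Ordinal 4 2 isT.
Definition vt : 'I_4 := @Ordinal 4 3 isT.

Definition Qop (m : nat) (P : {mpoly int[4]}) : {mpoly int[4]} :=
  ('X_vx + m%:R * 'X_vz) * P
  + ('X_vy + 'X_vt) * (m%:R * P + 'X_vy * mderiv vy P).

(* Qrec m = Q_{m+1} *)
Fixpoint Qrec (m : nat) : {mpoly int[4]} :=
  match m with
  | 0 => 1
  | m'.+1 => Qop m'.+1 (Qrec m')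
  end.

(* Q m = Q_m, for m >= 1 (Q_1 = 1, Q_{m+1} = Qop m Q_m). *)
Definition Q (m : nat) : {mpoly int[4]} := Qrec m.-1.

(* Q_{m,k}(r,t) as a polynomial in t:  Q_m(r,y,1,t) is evaluated in
   {poly {poly int}} with outer variable y and inner variable t, and
   the coefficient of y^k is taken. *)
Definition Qeval_env (r : nat) (i : 'I_4) : {poly {poly int}} :=
  if i == vx then r%:R
  else if i == vy then 'X
  else if i == vz then 1
  else ('X)%:P.

Definition Qmk (m k r : nat) : {poly int} :=
  (mmap (fun c : int => c%:~R) (Qeval_env r) (Q m))`_k.

Local Close Scope ring_scope.
(* Vertex labels 1..n are encoded by indices 0..n-1 of 'I_n (label = index+1;
   the shift preserves the order of labels).  The roots 1..r are the indices
   i < r.  A plane forest is encoded by a pair (g, p) of finite functions: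
   - g : parent function, with g i = i exactly for roots;
   - p : position of a non-root vertex among its brothers (0 = leftmost),
         p i = i for roots (normalisation). *)
Definition pforest n := ({ffun 'I_n -> 'I_n} * {ffun 'I_n -> 'I_n})%type.

Section Forest.
Variables (n r : nat).
Implicit Types (F : pforest n) (i j k : 'I_n).

Definition isroot i : bool := i < r.

Definition sibs F j : {set 'I_n} :=
  [set k | ~~ isroot k & F.1 k == F.1 j].

Definition valid_forest F : bool :=
  [&& [forall i, (F.1 i == i) == isroot i],
      [forall j, isroot (iter n F.1 j)],              (* every vertex reaches a root: acyclic *)
      [forall i, isroot i ==> (F.2 i == i)],
      [forall j, ~~ isroot j ==> (F.2 j < #|sibs F j|)] &
      [forall j, forall k, [&& ~~ isroot j, ~~ isroot k, F.1 j == F.1 k &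
                             F.2 j == F.2 k] ==> (j == k)]].

Definition desc F i j : bool := [exists d : 'I_n.+1, iter d F.1 j == i].

Definition beta F i : nat := \big[minn/(i : nat)]_(j | desc F i j) (j : nat).

Definition elder F j : bool :=
  ~~ isroot j &&
  [exists k, [&& ~~ isroot k, k != j, F.1 k == F.1 j, F.2 j < F.2 k &
                 beta F k < beta F j]].

(* the edge (g j, j) of a non-root j is proper iff j is elder or g j < beta j *)
Definition improper F j : bool :=
  ~~ isroot j && ~~ (elder F j || (F.1 j < beta F j)).

Definition n_improper F : nat := #|[set j | improper F j]|.
Definition eld F : nat := #|[set j | elder F j]|.

End Forest.

(* Main.v *)
(** A plane forest is read as a binary tree ("first child, next brother").  The
forests with one more vertex are obtained by inserting the new largest label M:
as a rightmost leaf (weight 1), as a leaf just left of a non-root vertex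
(weight t), in the middle of an edge (weight y), or at an improper edge (i, c):
if c_1, ..., c_m are the children of i and c = c_s, then M takes the place of i
and gets the children c_1, ..., c_s, i (weight y) or c_1, ..., c_(s-1), i, c_s
(weight t), while i keeps c_(s+1), ..., c_m.  In the last case the smallest
descendant of i is now larger than that of c_s, so all other vertices keep their
status, and comparing the smallest descendants of the last two children of M
tells the two variants apart; hence every forest arises exactly once.  With y
marking improper edges this is the recurrence
  W_(n+1) = n W_n + (y + t) ((n - r) W_n + y W_n'),
which is the one defining Q. *)
Require Import Defs.
From HB Require Import structures.
From mathcomp Require Import all_boot all_order all_algebra.
From mathcomp Require Import mpoly.
From mathcomp Require Import zify ring.
Set Implicit Arguments. Unset Strict Implicit. Unset Printing Implicit Defensive.
Import GRing.Theory.

(** * Plane forests as binary trees *)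

(* [Node i L R]: the vertex i with the list L of its children, followed by the list
   R of its brothers to the right; a tree thus encodes an ordered list of siblings. *)
Inductive tree := Leaf | Node of nat & tree & tree.

Lemma tree_comparable : comparable tree.
Proof. by rewrite /comparable /decidable; do 2 decide equality. Defined.

HB.instance Definition _ := comparableMixin tree_comparable.

Fixpoint labels T := if T is Node i L R then i :: labels L ++ labels R else [::].
Fixpoint spine T := if T is Node i _ R then i :: spine R else [::].

Definition min_desc i L := foldr minn i (labels L).
(** [R] holds the brothers to the right together with all their descendants, so a label of [R] below
    [min_desc i L] amounts to a right brother with a smaller least descendant. *)
Definition elder_node i L R := has (gtn (min_desc i L)) (labels R).

Lemma min_desc_lt i L k : (min_desc i L < k) = has (gtn k) (i :: labels L).
Proof.
rewrite /min_desc /=; elim: (labels L) => [|x s IH] /=; first by rewrite orbF.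
by rewrite gtn_min IH orbCA.
Qed.

Lemma min_desc_eq i L j L' :
  (forall k, has (gtn k) (i :: labels L) = has (gtn k) (j :: labels L')) ->
  min_desc i L = min_desc j L'.
Proof.
move=> h; apply/eqP; rewrite eqn_leq; apply/andP; split.
  by rewrite -ltnS min_desc_lt h -min_desc_lt.
by rewrite -ltnS min_desc_lt -h -min_desc_lt.
Qed.

Lemma min_desc_mem i L : min_desc i L \in i :: labels L.
Proof.
rewrite /min_desc; elim: (labels L) => [|x s IH] /=; first by rewrite inE.
rewrite !inE /minn; case: ltnP => _; first by rewrite eqxx orbT.
by move: IH; rewrite inE => /orP[->//|->]; rewrite !orbT.
Qed.

(* [improper_children v T] counts the improper edges from v to the siblings listed
   in T, [improper_below T] those strictly below them. *)
Fixpoint improper_children v T :=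
  if T is Node c C R then
    (~~ elder_node c C R && (min_desc c C < v)) + improper_children v R
  else 0.
Fixpoint improper_below T :=
  if T is Node i L R then improper_children i L + improper_below L + improper_below R else 0.

(* The child lists of M when M replaces the vertex i, whose child list is L; there
   are two of them for each improper edge from i. *)
Fixpoint split_at i L : seq tree :=
  if L is Node c C R then
    (if ~~ elder_node c C R && (min_desc c C < i)
     then [:: Node c C (Node i R Leaf); Node i R (Node c C Leaf)] else [::])
    ++ [seq Node c C X | X <- split_at i R]
  else [::].

Fixpoint insert M T : seq tree :=
  if T is Node i L R then
    [:: Node M Leaf T, Node M (Node i L Leaf) R &
     [seq Node M X R | X <- split_at i L]
     ++ [seq Node i X R | X <- insert M L] ++ [seq Node i L X | X <- insert M R]]
  else [:: Node M Leaf Leaf].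

(* Here T lists the roots, which carry the smallest labels and stay roots. *)
Fixpoint insert_root M T : seq tree :=
  if T is Node i L R then
    [seq Node i X R | X <- insert M L] ++ [seq Node i L X | X <- insert_root M R]
  else [::].

(** Label multisets are compared by [count] for an arbitrary predicate. This serves both for
    permutations of labels and for the tests [has (gtn k)] behind [min_desc] and [elder_node]. *)
Lemma count_split_at a i L X :
  X \in split_at i L -> count a (labels X) = a i + count a (labels L).
Proof.
elim: L X => [|c C _ R IH] X //=; rewrite mem_cat => /orP[|/mapP[Y /IH e ->]]; last first.
  by rewrite /= !count_cat e; lia.
by case: ifP => // _; rewrite !inE => /orP[]/eqP->; rewrite /= !count_cat /= ?count_cat /=; lia.
Qed.

Lemma count_insert a M T X :
  X \in insert M T -> count a (labels X) = a M + count a (labels T).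
Proof.
elim: T X => [|i L IHL R IHR] X /=; first by rewrite inE => /eqP->.
rewrite !inE !mem_cat => /orP[/eqP->|/orP[/eqP->|/orP[/mapP[Y Yi ->]|/orP[]/mapP[Y Yi ->]]]] /=;
  rewrite ?count_cat /= ?count_cat /=; try lia.
- by rewrite (count_split_at _ Yi); lia.
- by rewrite (IHL _ Yi); lia.
- by rewrite (IHR _ Yi); lia.
Qed.

Lemma count_insert_root a M T X :
  X \in insert_root M T -> count a (labels X) = a M + count a (labels T).
Proof.
elim: T X => [|i L _ R IHR] X //=.
rewrite mem_cat => /orP[]/mapP[Y Yi ->] /=; rewrite ?count_cat.
- by rewrite (count_insert _ Yi); lia.
- by rewrite (IHR _ Yi); lia.
Qed.

(** The edge that is split is improper, so the subtree of its lower end contains a label below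
    [i]. *)
Lemma split_at_small i L X : X \in split_at i L -> has (gtn i) (labels L).
Proof.
elim: L X => [|c C _ R IH] X //=; rewrite mem_cat => /orP[|/mapP[Y /IH e _]]; last first.
  by rewrite has_cat e !orbT.
by case: ifP => // /andP[_]; rewrite min_desc_lt /= has_cat => /orP[]->; rewrite ?orbT.
Qed.

(** * Total weight of all insertions *)

Section Weight.
Local Open Scope ring_scope.
Variables (A : comNzRingType) (t y : A).

Definition node_weight v i L R : A :=
  if elder_node i L R then t else if (min_desc i L < v)%N then y else 1.

Fixpoint weight v T : A :=
  if T is Node i L R then node_weight v i L R * weight i L * weight v R else 1.
Fixpoint forest_weight T : A :=
  if T is Node i L R then weight i L * forest_weight R else 1.

(** At an improper edge (i, c) the weight y of c persists under M. The vertex i, now a child of M,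
    is elder in one variant and the end of an improper edge in the other, whence the factor t +
    y. *)
Lemma sum_split_at M i L :
  uniq (i :: labels L) -> all (gtn M) (i :: labels L) ->
  \sum_(X <- split_at i L) weight M X = (t + y) * (improper_children i L)%:R * weight i L.
Proof.
elim: L => [|c C _ R IH]; first by rewrite big_nil mulr0 mul0r.
move=> uL aL.
rewrite /= big_cat big_map /=.
have bM : (min_desc c C < M)%N by rewrite min_desc_lt /=; case/and3P: aL => _ /= ->.
have iM : (i < M)%N by case/andP: aL.
have -> : \sum_(X <- split_at i R) node_weight M c C X * weight c C * weight M X =
   node_weight i c C R * weight c C * ((t + y) * (improper_children i R)%:R * weight i R).
  rewrite -IH; first last.
  - by move: aL; rewrite /= all_cat => /and4P[-> _ _ ->].
  - by move: uL; rewrite /= !inE mem_cat cat_uniq !negb_or => /andP[/and3P[_ _ ->]/andP[_ /and3P[_ _ ->]]].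
  rewrite mulr_sumr; apply: eq_big_seq => X Xs; congr (_ * _ * _).
  have hR := split_at_small Xs.
  have eE : elder_node c C X = elder_node c C R.
    rewrite /elder_node has_count (count_split_at _ Xs) /= [RHS]has_count.
    (* If the new right brother [i] makes [c] elder, then so does the label of [R] below [i]. *)
    case: (ltnP i (min_desc c C)) => //= ib; symmetry; rewrite -has_count.
    by apply: sub_has hR => x /= xi; apply: ltn_trans ib.
  (* If [c] is not elder, its least descendant is at most every label of [R], and one of these is
     below [i]; so its edge is improper under [i] as well as under [M]. *)
  rewrite /node_weight eE bM; case: ifP => // /negbT; rewrite -all_predC => /allP nE.
  case/hasP: hR => x /nE /=; rewrite -leqNgt => h1 h2.
  by rewrite (leq_ltn_trans h1 h2).
case: ifP => [/andP[nE bi]|_] /=; last by rewrite big_nil; ring.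
rewrite !big_cons big_nil /=.
have lbR x : x \in labels R -> (min_desc c C < x)%N.
  move=> xR; rewrite ltn_neqAle; apply/andP; split.
    apply/eqP => e; have := min_desc_mem c C; rewrite e => xC.
    move: uL; rewrite -[labels _]/((c :: labels C) ++ labels R) cons_uniq cat_uniq.
    by case/and4P=> _ _ /hasPn/(_ _ xR); rewrite /= xC.
  by move: nE; rewrite /elder_node -all_predC => /allP/(_ _ xR) /=; rewrite -leqNgt.
(* The least descendant of [c] is below the labels of [R], as [c] is not elder, and below [i], as
   the edge is improper. This decides which of the last two children of [M] is elder. *)
have bb : (min_desc c C < min_desc i R)%N.
  by have := min_desc_mem i R; rewrite inE => /orP[/eqP->|/lbR].
have e1 : elder_node c C (Node i R Leaf) = false.
  rewrite /elder_node /= cats0 -/(elder_node c C R) (negbTE nE) orbF.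
  by apply/negbTE; rewrite -leqNgt ltnW.
have e2 : elder_node i R (Node c C Leaf) = true.
  by apply/hasP; exists (min_desc c C) => //=; rewrite cats0 min_desc_mem.
have e3 : (min_desc i R < M)%N by rewrite min_desc_lt /= iM.
rewrite /node_weight e1 e2 e3 (negbTE nE) /= bM bi.
by rewrite /elder_node /= natrD; ring.
Qed.

(** A rightmost leaf fits below each vertex of [T] and at the end of [T]. Each vertex contributes t
    (leaf to its left) and y (middle of the edge above it), and each improper edge inside [T]
    contributes t + y. Edges from [v] to the spine are not split here, since [v] lies outside
    [T]. *)
Lemma sum_insert M v T :
  (v < M)%N -> uniq (labels T) -> all (gtn M) (labels T) ->
  \sum_(X <- insert M T) weight v X =
  ((size (labels T)).+1%:R + (t + y) * (size (labels T) + improper_below T)%:R) * weight v T.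
Proof.
elim: T v => [|i L IHL R IHR] v vM.
  by move=> _ _; rewrite big_seq1 /= /node_weight /elder_node /= /min_desc /= ltnNge (ltnW vM) /=; ring.
move=> uT aT.
have [iM aL aR] : [/\ i < M, all (gtn M) (labels L) & all (gtn M) (labels R)]%N.
  by move: aT; rewrite /= all_cat => /and3P[].
have [uiL uL uR] : [/\ uniq (i :: labels L), uniq (labels L) & uniq (labels R)].
  move: uT; rewrite -[labels _]/((i :: labels L) ++ labels R) cat_uniq => /and3P[u _ ->].
  by split => //; case/andP: u.
rewrite [insert _ _]/= !big_cons !big_cat !big_map /=.
have bM : (min_desc i L < M)%N by rewrite min_desc_lt /= iM.
(* [M] takes the place of [i] and has the smaller label [i] below it, so the least descendant at
   this place does not change. *)
have fM X : (forall a, count a (labels X) = a i + count a (labels L))%N ->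
  node_weight v M X R = node_weight v i L R.
  move=> cX; have e : min_desc M X = min_desc i L.
    apply: min_desc_eq => k /=; rewrite has_count cX /=.
    rewrite (has_count _ (labels L)).
    case: (ltnP i k) => //=; case: (ltnP M k) => //=; lia.
  by rewrite /node_weight /elder_node e.
have -> : node_weight v M Leaf (Node i L R) = t by rewrite /node_weight /elder_node /= /min_desc /= iM.
have -> : node_weight v M (Node i L Leaf) R = node_weight v i L R.
  by apply: fM => a; rewrite /= cats0.
have -> : node_weight M i L Leaf = y by rewrite /node_weight /elder_node /= bM.
have -> : \sum_(X <- split_at i L) node_weight v M X R * weight M X * weight v R =
   node_weight v i L R * weight v R * ((t + y) * (improper_children i L)%:R * weight i L).
  rewrite -(sum_split_at (M := M) uiL); last by rewrite /= iM.
  rewrite mulr_sumr; apply: eq_big_seq => X Xs.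
  rewrite fM; first by ring.
  by move=> a; apply: count_split_at.
have -> : \sum_(X <- insert M L) node_weight v i X R * weight i X * weight v R =
   node_weight v i L R * weight v R *
   (((size (labels L)).+1%:R + (t + y) * (size (labels L) + improper_below L)%:R) * weight i L).
  rewrite -IHL // mulr_sumr; apply: eq_big_seq => X Xs.
  have e : min_desc i X = min_desc i L.
    apply: min_desc_eq => k /=; rewrite has_count (count_insert _ Xs) /= (has_count _ (labels L)).
    case: (ltnP i k) => //=; case: (ltnP M k) => //=; lia.
  by rewrite /node_weight /elder_node e; ring.
have -> : \sum_(X <- insert M R) node_weight v i L X * weight i L * weight v X =
   node_weight v i L R * weight i L *
   (((size (labels R)).+1%:R + (t + y) * (size (labels R) + improper_below R)%:R) * weight v R).
  rewrite -IHR // mulr_sumr; apply: eq_big_seq => X Xs.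
  (* [M] exceeds the least descendant of [i], so its presence to the right cannot make [i] elder. *)
  have e : elder_node i L X = elder_node i L R.
    rewrite /elder_node has_count (count_insert _ Xs) /= (has_count _ (labels R)).
    by rewrite [(M < _)%N]ltnNge (ltnW bM).
  by rewrite /node_weight e; ring.
rewrite size_cat -!natr1 !natrD -?natr1 ?natrD; ring.
Qed.

End Weight.

(** * Lists of roots with the smallest labels *)

Lemma labels_split T x : x \in spine T -> x \in labels T.
Proof.
elim: T => //= i L _ R IH; rewrite !inE mem_cat => /orP[->//|/IH->].
by rewrite !orbT.
Qed.

Definition low_roots T :=
  {in spine T & labels T, forall i x, x \notin spine T -> i < x}.

Lemma low_rootsP i L R : uniq (labels (Node i L R)) ->
  low_roots (Node i L R) -> all (ltn i) (labels L) /\ low_roots R.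
Proof.
rewrite /= mem_cat cat_uniq negb_or => /and3P[/andP[iL iR] _ /andP[/hasPn LR _]] lr; split.
  apply/allP => x xL; apply: lr; rewrite /= !inE ?mem_cat ?eqxx ?xL ?orbT //.
  rewrite negb_or; apply/andP; split; first by apply: contraNneq iL => <-.
  by apply: contraL xL => /labels_split/LR.
move=> j x jR xR xs; apply: lr; rewrite /= !inE ?mem_cat ?jR ?xR ?orbT //.
by rewrite negb_or xs andbT; apply: contraNneq iR => <-.
Qed.

(** Applied with a root as [v], this removes the edges at roots from the count of improper edges. *)
Lemma improper_children0 v T : all (ltn v) (labels T) -> improper_children v T = 0.
Proof.
elim: T => //= i L _ R IH; rewrite all_cat => /and3P[vi vL vR].
rewrite IH // addn0 min_desc_lt /= (ltnNge i) (ltnW vi) /=.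
rewrite (_ : has _ _ = false) ?andbF //; apply/negbTE; rewrite -all_predC.
by apply: sub_all vL => x /=; rewrite -leqNgt => /ltnW.
Qed.

Section Root.
Local Open Scope ring_scope.
(** By [sum_insert], a root with child list [L] has |L| + 1 places for a rightmost leaf and |L|
    vertices contributing t + y; over all roots these add up to the number of labels and the number
    of non-roots. *)
Lemma sum_insert_root (A : comNzRingType) (t y : A) M T :
  uniq (labels T) -> all (gtn M) (labels T) -> low_roots T ->
  \sum_(X <- insert_root M T) forest_weight t y X =
  ((size (labels T))%:R + (t + y) *
     ((size (labels T))%:R - (size (spine T))%:R + (improper_below T)%:R)) * forest_weight t y T.
Proof.
elim: T => [|i L _ R IHR] uT aT lT; first by rewrite big_nil /=; ring.
have [iL lR] := low_rootsP uT lT.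
have [uL uR] : uniq (labels L) /\ uniq (labels R).
  by move: uT; rewrite /= cat_uniq => /and3P[_ -> /andP[_ ->]].
have [iM aL aR] : [/\ i < M, all (gtn M) (labels L) & all (gtn M) (labels R)]%N.
  by move: aT; rewrite /= all_cat => /and3P[].
rewrite /= big_cat !big_map /= -mulr_suml sum_insert // -mulr_sumr IHR //.
rewrite improper_children0 // size_cat -!natr1 !natrD -?natr1 ?natrD; ring.
Qed.

(** The weight has one factor y per improper edge, so the Euler operator multiplies it by their
    number. This converts the count in [sum_insert_root] into a derivative. *)
Lemma deriv_weight (A : comNzRingType) (t : A) v T :
  'X * (weight t%:P 'X v T)^`() = (improper_children v T + improper_below T)%:R * weight t%:P 'X v T.
Proof.
elim: T v => [|i L IHL R IHR] v; first by rewrite /= derivC mulr0 mul0r.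
have e : 'X * (node_weight t%:P 'X v i L R)^`() =
    (~~ elder_node i L R && (min_desc i L < v)%N)%:R * node_weight t%:P 'X v i L R.
  rewrite /node_weight; case: elder_node => /=; first by rewrite derivC mulr0 mul0r.
  by case: ltnP => _; rewrite ?derivX ?derivC ?mulr0 ?mul0r ?mulr1 ?mul1r.
rewrite /= !derivM !natrD.
move: e (IHL i) (IHR v).
set F := node_weight _ _ _ _ _ _; set a := weight _ _ _ L; set b := weight _ _ _ R.
rewrite !natrD => e eL eR.
transitivity ('X * F^`() * a * b + F * ('X * a^`()) * b + F * a * ('X * b^`())); first by ring.
rewrite e eL eR; ring.
Qed.

Lemma deriv_forest_weight (A : comNzRingType) (t : A) T :
  uniq (labels T) -> low_roots T ->
  'X * (forest_weight t%:P 'X T)^`() = (improper_below T)%:R * forest_weight t%:P 'X T.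
Proof.
elim: T => [|i L _ R IHR] uT lT; first by rewrite /= derivC mulr0 mul0r.
have [iL lR] := low_rootsP uT lT.
have uR : uniq (labels R).
  by move: uT; rewrite /= cat_uniq => /and3P[_ _ /andP[_ ->]].
have := deriv_weight t i L; have := IHR uR lR.
rewrite /= derivM improper_children0 // add0n natrD.
set a := weight _ _ _ L; set b := forest_weight _ _ R => e1 e2.
transitivity (('X * a^`()) * b + a * ('X * b^`())); first by ring.
rewrite e1 e2; ring.
Qed.
End Root.

(** * Every tree arises from exactly one insertion *)

(** Tells the two variants of a split apart: of the last two brothers, the displaced vertex is the
    one with the larger least descendant. *)
Lemma min_desc_split i c C R : uniq (labels (Node c C R)) ->
  ~~ elder_node c C R && (min_desc c C < i) -> min_desc c C < min_desc i R.
Proof.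
move=> uL /andP[nE bi]; have := min_desc_mem i R; rewrite inE => /orP[/eqP->//|xR].
rewrite ltn_neqAle; apply/andP; split; last first.
  by move: nE; rewrite /elder_node -all_predC => /allP/(_ _ xR) /=; rewrite -leqNgt.
apply/eqP => e; have := min_desc_mem c C; rewrite e => xC.
move: uL; rewrite -[labels _]/((c :: labels C) ++ labels R) cat_uniq.
by case/and3P=> _ /hasPn/(_ _ xR); rewrite /= xC.
Qed.

(* Inverse of [split_at], also undoing the insertion in the middle of an edge:
   returns the vertex that M has replaced and its child list; (0, Leaf) is a junk value. *)
Fixpoint unsplit X : nat * tree :=
  match X with
  | Leaf => (0, Leaf)
  | Node a C X' =>
    match X' with
    | Leaf => (a, C)
    | Node b D Leaf =>
        if min_desc a C < min_desc b D then (b, Node a C D) else (a, Node b D C)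
    | _ => ((unsplit X').1, Node a C (unsplit X').2)
    end
  end.

Fixpoint delete M T : tree :=
  if T is Node i L R then
    if i == M then
      if L is Leaf then R else Node (unsplit L).1 (unsplit L).2 R
    else Node i (delete M L) (delete M R)
  else Leaf.

(** Having at least two entries separates the child lists of a split from the single child left by
    an insertion in the middle of an edge. *)
Lemma split_at_shape i L X : X \in split_at i L ->
  exists a C b D Z, X = Node a C (Node b D Z).
Proof.
elim: L X => [|c C _ R IH] X //=; rewrite mem_cat => /orP[|/mapP[Y /IH[a [A [b [D [Z ->]]]]] ->]].
  by case: ifP => // _; rewrite !inE => /orP[]/eqP->; do 5 eexists.
by do 5 eexists.
Qed.

Lemma split_atK i L X : uniq (i :: labels L) ->
  X \in Node i L Leaf :: split_at i L -> unsplit X = (i, L).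
Proof.
elim: L X => [|c C _ R IH] X; first by rewrite inE => _ /eqP->.
move=> uL; rewrite inE => /orP[/eqP->//|].
have uL' : uniq (labels (Node c C R)) by case/andP: uL.
rewrite [split_at _ _]/= mem_cat => /orP[|/mapP[Y Ys ->]].
  case: ifP => // /(min_desc_split uL') lt; rewrite !inE => /orP[]/eqP-> /=.
    by rewrite lt.
  by rewrite ltnNge ltnW.
have := split_at_shape Ys => -[a [A [b [D [Z eY]]]]].
have /(IH _ _) : Y \in Node i R Leaf :: split_at i R by rewrite inE Ys orbT.
rewrite eY => /= ->//.
move: uL; rewrite /= !inE mem_cat cat_uniq !negb_or.
by move=> /andP[/and3P[_ _ ->]/and4P[_ _ _ ->]].
Qed.

(** A single child comes from the middle of an edge. Of two children, the one with the larger least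
    descendant was displaced, and the inequalities needed for a split follow from distinct labels.
    Longer lists reduce to their tails. *)
Lemma unsplitK X : X != Leaf -> uniq (labels X) ->
  X \in Node (unsplit X).1 (unsplit X).2 Leaf :: split_at (unsplit X).1 (unsplit X).2.
Proof.
elim: X => // a C _ [|b D Z] IH _ uX; first by rewrite /= inE eqxx.
have bD x : x \in labels D -> min_desc b D <= x.
  by move=> xD; rewrite -ltnS min_desc_lt; apply/hasP; exists x; rewrite ?inE ?xD ?orbT /=.
have bC x : x \in labels C -> min_desc a C <= x.
  by move=> xD; rewrite -ltnS min_desc_lt; apply/hasP; exists x; rewrite ?inE ?xD ?orbT /=.
have bb : min_desc b D <= b by rewrite -ltnS min_desc_lt /= ltnSn.
have aa : min_desc a C <= a by rewrite -ltnS min_desc_lt /= ltnSn.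
case: Z IH uX => [_|b' D' Z IH] uX.
  rewrite /=; case: ltnP => h; rewrite in_cons /= mem_cat; apply/orP; right;
    apply/orP; left.
    rewrite (leq_trans h bb) andbT.
    case: ifP => [_|/negbFE/hasP[x /bD/= ]]; last by lia.
    by rewrite !inE eqxx.
  have -> : min_desc b D < a.
    rewrite ltn_neqAle (leq_trans h aa) andbT; apply/eqP => e.
    have := min_desc_mem b D; rewrite e => xD.
    by move: uX; rewrite /= cats0 mem_cat xD orbT.
  rewrite andbT; case: ifP => [_|/negbFE/hasP[x /bC/= ]]; last by lia.
  by rewrite !inE eqxx orbT.
set Y := Node b D _ in IH uX *.
have uY : uniq (labels Y).
  move: uX; rewrite -[labels _]/(a :: labels C ++ labels Y) cons_uniq cat_uniq.
  by case/and4P.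
have := IH isT uY.
rewrite -[unsplit (Node a C Y)]/((unsplit Y).1, Node a C (unsplit Y).2) inE => /orP[/eqP|h].
  by case: (unsplit Y) => ? ?.
by rewrite inE /= mem_cat map_f ?orbT.
Qed.

Lemma delete_id M T : M \notin labels T -> delete M T = T.
Proof.
elim: T => //= i L IHL R IHR; rewrite !inE mem_cat !negb_or eq_sym.
by move=> /and3P[/negbTE-> /IHL-> /IHR->].
Qed.

Lemma uniq_cons_node M i L R : uniq (M :: labels (Node i L R)) ->
  [/\ (i == M) = false, uniq (M :: labels L), uniq (M :: labels R)
    & uniq (i :: labels L)].
Proof.
rewrite /= inE !mem_cat cat_uniq !negb_or eq_sym.
by case/andP=> /and3P[/negbTE-> -> ->] /and4P[/andP[-> _] -> _ ->].
Qed.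

Lemma insertK M T X : uniq (M :: labels T) -> X \in insert M T -> delete M X = T.
Proof.
elim: T X => [|i L IHL R IHR] X; first by rewrite inE => _ /eqP-> /=; rewrite eqxx.
move=> /uniq_cons_node[iM uL uR uiL]; rewrite [insert _ _]/= !inE !mem_cat.
move=> /orP[/eqP->|/orP[/eqP->|/orP[/mapP[Y Yi ->]|/orP[]/mapP[Y Yi ->]]]] /=;
  rewrite ?eqxx ?iM //.
- have /(split_atK uiL)-> : Y \in Node i L Leaf :: split_at i L by rewrite inE Yi orbT.
  by have := split_at_shape Yi => -[a [A [b [D [Z ->]]]]].
- by rewrite (IHL _ uL Yi) delete_id; case/andP: uR.
- by rewrite (IHR _ uR Yi) delete_id; case/andP: uL.
Qed.

Lemma insert_rootK M T X : uniq (M :: labels T) -> X \in insert_root M T -> delete M X = T.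
Proof.
elim: T X => [|i L _ R IHR] X // /uniq_cons_node[iM uL uR _].
rewrite mem_cat => /orP[]/mapP[Y Yi ->] /=; rewrite iM.
- by rewrite (insertK uL Yi) delete_id; case/andP: uR.
- by rewrite (IHR _ uR Yi) delete_id; case/andP: uL.
Qed.

Lemma deleteK M X : uniq (labels X) -> M \in labels X -> X \in insert M (delete M X).
Proof.
elim: X => // i L IHL R IHR; rewrite [labels _]/= cons_uniq mem_cat cat_uniq negb_or.
move=> /and3P[/andP[iL iR] uL /andP[/hasPn LR uR]].
rewrite inE mem_cat eq_sym /=; case: eqP => [->|_] /=.
  case: L uL {IHL iL LR} => [|j C S] uL _; first by case: R {IHR iR uR} => *; rewrite inE eqxx.
  have := unsplitK (X := Node j C S) isT uL; rewrite inE => /orP[/eqP e|h].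
    by rewrite {1}e [insert _ _]/= !inE eqxx orbT.
  by rewrite [insert _ _]/= !inE mem_cat map_f ?orbT.
case: (boolP (M \in labels L)) => [ML _|ML /= MR].
  rewrite (_ : delete M R = R); last by apply: delete_id; apply/negP => /LR; rewrite ML.
  by rewrite [insert _ _]/= !inE !mem_cat map_f ?orbT // IHL.
by rewrite (delete_id ML) [insert _ _]/= !inE !mem_cat (map_f (Node i L)) ?orbT // IHR.
Qed.

Lemma delete_rootK M X : uniq (labels X) -> M \in labels X -> M \notin spine X ->
  X \in insert_root M (delete M X).
Proof.
elim: X => // i L _ R IHR; rewrite [labels _]/= cons_uniq mem_cat cat_uniq negb_or.
move=> /and3P[/andP[iL iR] uL /andP[/hasPn LR uR]].
rewrite !inE mem_cat eq_sym /=; case: eqP => //= _.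
case: (boolP (M \in labels L)) => [ML _|ML /= MR] Ms.
  rewrite (_ : delete M R = R); last by apply: delete_id; apply/negP => /LR; rewrite ML.
  by rewrite /= mem_cat map_f // deleteK.
by rewrite (delete_id ML) /= mem_cat (map_f (Node i L)) ?orbT // IHR.
Qed.

Lemma uniq_split_at i L : uniq (i :: labels L) -> uniq (split_at i L).
Proof.
elim: L => // c C _ R IH; rewrite /= inE mem_cat cat_uniq !negb_or.
move=> /andP[/and3P[ic iC iR] /and4P[_ _ _ uR]].
rewrite cat_uniq map_inj_uniq ?IH /= ?iR // => [|? ? []//]; rewrite andbT.
apply/andP; split.
  case: ifP => // _; rewrite /= andbT inE.
  by apply: contra ic => /eqP[->].
apply/hasPn => X /mapP[Y Ys ->]; case: ifP => // _; rewrite !inE negb_or.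
apply/andP; split; last by apply: contra ic => /eqP[->].
by have := split_at_shape Ys => -[a [A [b [D [Z ->]]]]]; apply/eqP.
Qed.

Lemma mem_insert M T X : X \in insert M T -> M \in labels X.
Proof. by move=> /(count_insert (pred1 M)) h; rewrite -has_pred1 has_count h /= eqxx. Qed.

(** The kinds of insertion are separated by the first label ([M] or [i]), by the number of children
    of [M] (none, one, at least two), and by whether [M] lies in [L]. *)
Lemma uniq_insert M T : uniq (M :: labels T) -> uniq (insert M T).
Proof.
elim: T => // i L IHL R IHR /uniq_cons_node[iM uL uR uiL].
have eMi : (M == i) = false by rewrite eq_sym.
have ML : M \notin labels L by case/andP: uL.
rewrite [insert _ _]/= !cons_uniq !cat_uniq !map_inj_uniq => [|? ? []//|? ? []//|? ? []//].
rewrite uniq_split_at // IHL // IHR // !inE !mem_cat !negb_or has_cat negb_or.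
repeat (apply/andP; split) => //.
- by apply/eqP.
- by apply/mapP => -[Y Yi [e _]]; have := split_at_shape Yi; rewrite -e => -[? [? [? [? []]]]].
- by apply/mapP => -[Y Yi [e _]]; rewrite e eqxx in iM.
- by apply/mapP => -[Y Yi [e _]]; rewrite e eqxx in iM.
- by apply/mapP => -[Y Yi [e]]; have := split_at_shape Yi; rewrite -e => -[? [? [? [? []]]]].
- by apply/mapP => -[Y Yi [e _]]; rewrite e eqxx in iM.
- by apply/mapP => -[Y Yi [e _]]; rewrite e eqxx in iM.
- by apply/hasPn => X /mapP[Y _ ->]; apply/mapP => -[Z _ [e]]; rewrite e eqxx in iM.
- by apply/hasPn => X /mapP[Y _ ->]; apply/mapP => -[Z _ [e]]; rewrite e eqxx in iM.
apply/hasPn => X /mapP[Y _ ->]; apply/mapP => -[Z /mem_insert ZL [e _]].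
by move: ML; rewrite e ZL.
Qed.

Lemma uniq_insert_root M T : uniq (M :: labels T) -> uniq (insert_root M T).
Proof.
elim: T => // i L _ R IHR /uniq_cons_node[iM uL uR _].
rewrite [insert_root _ _]/= cat_uniq !map_inj_uniq => [|? ? []//|? ? []//].
rewrite uniq_insert // IHR // andbT.
apply/hasPn => X /mapP[Y _ ->]; apply/mapP => -[Z /mem_insert ZL [e _]].
by move: uL; rewrite /= e ZL.
Qed.

Lemma spine_insert_root M T X : X \in insert_root M T -> spine X = spine T.
Proof.
elim: T X => // i L _ R IH X /=; rewrite mem_cat => /orP[]/mapP[Y Yi ->] //=.
by rewrite (IH _ Yi).
Qed.

(** * Enumeration of all forests with given roots *)

Fixpoint trees r m : seq tree :=
  if m is m'.+1 then flatten [seq insert_root (r + m') T | T <- trees r m']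
  else [:: foldr (fun i => Node i Leaf) Leaf (iota 0 r)].

Definition is_tree r n T := perm_eq (labels T) (iota 0 n) && (spine T == iota 0 r).

Lemma perm_labels_insert_root n M T X : X \in insert_root M T ->
  perm_eq (labels T) n -> perm_eq (labels X) (rcons n M).
Proof.
move=> Xi /permP h; apply/permP => a.
by rewrite (count_insert_root _ Xi) h -cats1 count_cat /= addn0 addnC.
Qed.

Lemma iotaSr n : iota 0 n.+1 = rcons (iota 0 n) n.
Proof. by rewrite -[n.+1]addn1 iotaD cats1. Qed.

(** The largest label is not a root once m is positive; deleting it leaves a smaller tree, from
    which [T] arises by [insert_root]. *)
Lemma mem_trees r m T : (T \in trees r m) = is_tree r (r + m) T.
Proof.
elim: m T => [|m IH] T.
  rewrite addn0 inE; apply/eqP/andP => [->|[]].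
    set s := iota 0 r; split; first by rewrite (_ : labels _ = s) //; elim: s => //= a s ->.
    by apply/eqP; elim: s => //= a s ->.
  move=> /perm_size; rewrite size_iota => sz /eqP e; rewrite -e.
  (* There are as many labels as roots, which forces all child lists to be empty. *)
  have {}e : size (labels T) = size (spine T) by rewrite e size_iota.
  have sl X : size (spine X) <= size (labels X).
    by elim: X => //= i L _ R IHR; rewrite size_cat; lia.
  elim: T e {sz} => //= i L _ R IHR; rewrite size_cat.
  have := sl R; case: L => [|j C S] /=; last by lia.
  by move=> _ /succn_inj/IHR<-.
apply/flattenP/idP => [[_ /mapP[U UT ->] Ti]|].
  move: UT; rewrite IH => /andP[pU sU]; rewrite /is_tree (spine_insert_root Ti) sU andbT.
  by rewrite addnS iotaSr; apply: perm_labels_insert_root Ti pU.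
rewrite addnS => /andP[pT /eqP sT].
have uT : uniq (labels T) by rewrite (perm_uniq pT) iota_uniq.
have MT : r + m \in labels T by rewrite (perm_mem pT) mem_iota /=.
have Ms : r + m \notin spine T by rewrite sT mem_iota; lia.
have Ti := delete_rootK uT MT Ms.
exists (insert_root (r + m) (delete (r + m) T)) => //; apply: map_f.
rewrite IH /is_tree -(spine_insert_root Ti) sT eqxx andbT.
apply/permP => a; apply: (@addnI (a (r + m))).
rewrite -(count_insert_root _ Ti) (permP pT) iotaSr -cats1 count_cat /=; lia.
Qed.

Lemma is_tree_uniq r n T : is_tree r n T -> uniq (labels T).
Proof. by move=> /andP[/perm_uniq-> _]; rewrite iota_uniq. Qed.

Lemma is_tree_lt r n T x : is_tree r n T -> (x \in labels T) = (x < n).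
Proof. by move=> /andP[/perm_mem-> _]; rewrite mem_iota. Qed.

Lemma uniq_max_label r n T : is_tree r n T -> uniq (n :: labels T).
Proof. by move=> h; rewrite /= (is_tree_uniq h) (is_tree_lt _ h) ltnn. Qed.

(** Different trees have disjoint lists of insertions, because [delete] recovers the tree that was
    extended. *)
Lemma uniq_trees r m : uniq (trees r m).
Proof.
elim: m => // m IH; rewrite /=.
have : {in trees r m, forall T, uniq (r + m :: labels T)}.
  by move=> T; rewrite mem_trees => /uniq_max_label.
elim: (trees r m) IH => //= T s IHs /andP[Ts us] h.
have hs : {in s, forall U, uniq (r + m :: labels U)}.
  by move=> U Us; apply: h; rewrite inE Us orbT.
rewrite cat_uniq uniq_insert_root ?IHs ?andbT //; last by apply: h; rewrite mem_head.
apply/hasPn => X /flattenP[_ /mapP[U Us ->] XU]; apply/negP => XT.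
have eU : delete (r + m) X = U by apply: (insert_rootK _ XU); apply: h; rewrite inE Us orbT.
have eT : delete (r + m) X = T by apply: (insert_rootK _ XT); apply: h; rewrite mem_head.
by move: Ts; rewrite -eT eU Us.
Qed.

Lemma is_tree_low_roots r n T : is_tree r n T -> low_roots T.
Proof. by move=> /andP[_ /eqP e] i x; rewrite e !mem_iota; lia. Qed.

(** * The recurrence *)

Section Recurrence.
Local Open Scope ring_scope.
Variable r : nat.

Definition tree_poly T : {poly {poly int}} := forest_weight ('X)%:P 'X T.
Definition tree_sum m := \sum_(T <- trees r m) tree_poly T.

Lemma tree_sumS m :
  tree_sum m.+1 = (r + m)%:R * tree_sum m +
    ('X + ('X)%:P) * (m%:R * tree_sum m + 'X * (tree_sum m)^`()).
Proof.
rewrite /tree_sum /= big_flatten big_map /= raddf_sum !mulr_sumr -big_split /= mulr_sumr -big_split /=.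
apply: eq_big_seq => T; rewrite mem_trees => tT.
have [pT /eqP sT] := andP tT.
have uT := is_tree_uniq tT; have lT := is_tree_low_roots tT.
rewrite sum_insert_root ?deriv_forest_weight //; last first.
  by apply/allP => x; rewrite (is_tree_lt _ tT).
rewrite sT size_iota (perm_size pT) size_iota natrD -/(tree_poly T); ring.
Qed.

(** * Evaluation of the polynomials [Q] *)

Definition Qeval m := mmap (fun c : int => c%:~R) (Qeval_env r) (Q m).

(** Polynomials satisfying the identity are closed under sums and products, by the Leibniz rule, so
    constants and variables suffice. The hypotheses on [h] say that only the variable [i] goes to
    something depending on ['X]. *)
Lemma mmap_euler n (R : comNzRingType) (f : {rmorphism int -> {poly R}})
    (h : 'I_n -> {poly R}) i (p : {mpoly int[n]}) :
  h i = 'X -> (forall j, j != i -> (h j)^`() = 0) ->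
  mmap f h ('X_i * mderiv i p) = 'X * (mmap f h p)^`().
Proof.
move=> hi hj.
pose P q := mmap f h ('X_i * mderiv i q) = 'X * (mmap f h q)^`().
have PM q1 q2 : P q1 -> P q2 -> P (q1 * q2).
  rewrite /P => e1 e2.
  rewrite mderivM mulrDr rmorphD !(rmorphM, derivM) /=.
  move: e1 e2; rewrite !rmorphM /=.
  set a := mmap f h 'X_i; set b := mmap f h q1; set c := mmap f h q2 => e1 e2.
  transitivity ((a * mmap f h q1^`M(i)) * c + b * (a * mmap f h q2^`M(i))); first by ring.
  by rewrite e1 e2; ring.
have PC c : P c%:MP.
  have fc : f c = (c%:~R)%:P by rewrite [RHS]rmorph_int -[c in LHS]intz rmorph_int.
  by rewrite /P mderivC mulr0 mmap0 mmapC /= fc derivC mulr0.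
have PD q1 q2 : P q1 -> P q2 -> P (q1 + q2).
  by rewrite /P => e1 e2; rewrite mderivD mulrDr !mmapD derivD mulrDr e1 e2.
have PX j : P 'X_j.
  rewrite /P mderivX mnm1E mulrC -scalerAl [in RHS]mmapX mmap1U.
  case: (eqVneq j i) => [->|ne]; last by rewrite scale0r mmap0 hj ?mulr0.
  by rewrite scale1r -mpolyXD submK ?lepm_refl // mmapX mmap1U hi derivX mulr1.
have PXm m : P 'X_[m].
  rewrite mpolyXE_id; elim/big_ind: _ => // [|j _]; first exact: PC.
  by elim: (m j) => [|k IH]; [exact: PC | rewrite exprS; apply: PM].
change (P p); elim/mpolyind: p => [|c m p _ _ IH].
  by rewrite /P !(mderiv0, mmap0, mulr0, linear0).
by apply: PD => //; rewrite -mul_mpolyC; apply: PM.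
Qed.

Lemma QevalS m : Qeval m.+2 = (r + m.+1)%:R * Qeval m.+1 +
    ('X + ('X)%:P) * (m.+1%:R * Qeval m.+1 + 'X * (Qeval m.+1)^`()).
Proof.
rewrite /Qeval -[Q m.+2]/(Qop m.+1 (Q m.+1)) /Qop.
rewrite -(@mmap_euler 4 _ (intmul 1 : {rmorphism int -> {poly {poly int}}}) _ vy) //; last first.
  move=> j; rewrite /Qeval_env => /negbTE->.
  case: ifP => _; first by rewrite derivMn derivC mul0rn.
  by case: ifP => _; rewrite derivC.
rewrite !(rmorphD, rmorphM, rmorph_nat) /= !mmapX !mmap1U /Qeval_env /=.
by rewrite mulr1.
Qed.

(** Both sides obey the same recurrence. The factor r stems from the first step, where the first
    non-root is attached to any of the r roots. *)
Lemma tree_sumE m : tree_sum m.+1 = r%:R * Qeval m.+1.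
Proof.
have g0 : tree_sum 0 = 1.
  rewrite /tree_sum big_seq1 /tree_poly; elim: (iota 0 r) => //= a s ->.
  by rewrite mul1r.
elim: m => [|m IH].
  by rewrite tree_sumS g0 addn0 derivC /Qeval rmorph1; ring.
have e : (r%:R * Qeval m.+1)^`() = r%:R * (Qeval m.+1)^`() by rewrite !mulr_natl derivMn.
rewrite tree_sumS IH QevalS e; ring.
Qed.
End Recurrence.

(** * From parent and position functions to trees *)

Fixpoint tree_children T x : seq nat :=
  if T is Node i L R then
    if i == x then spine L else tree_children L x ++ tree_children R x
  else [::].

Lemma tree_children_par T x i : x \in tree_children T i -> i \in labels T.
Proof.
elim: T => //= j L IHL R IHR; rewrite inE mem_cat eq_sym.
by case: eqP => //= _; rewrite mem_cat => /orP[/IHL|/IHR] ->; rewrite ?orbT.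
Qed.

Lemma tree_children_nil T i : i \notin labels T -> tree_children T i = [::].
Proof.
by case e: (tree_children T i) => [//|x s]; rewrite (@tree_children_par T x i) // e mem_head.
Qed.

Lemma tree_children_sub T x i : x \in tree_children T i -> x \in labels T.
Proof.
elim: T => //= j L IHL R IHR; rewrite inE mem_cat.
case: eqP => _; first by move/labels_split ->; rewrite orbT.
by rewrite mem_cat => /orP[/IHL|/IHR] ->; rewrite ?orbT.
Qed.

Lemma uniq_node i L R : uniq (labels (Node i L R)) ->
  [/\ i \notin labels L, i \notin labels R, uniq (labels L), uniq (labels R)
    & {in labels L, forall x, x \notin labels R}].
Proof.
rewrite /= mem_cat cat_uniq negb_or => /and3P[/andP[-> ->] -> /andP[/hasPn LR ->]].
by split=> // x xL; apply: contraL xL => /LR.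
Qed.

Lemma tree_childrenE i L R x : uniq (labels (Node i L R)) ->
  tree_children (Node i L R) x =
  if i == x then spine L else if x \in labels L then tree_children L x else tree_children R x.
Proof.
move=> /uniq_node[_ _ _ _ LR] /=; case: ifP => // _.
case: ifP => xL; first by rewrite (tree_children_nil (LR _ xL)) cats0.
by rewrite tree_children_nil ?xL.
Qed.

Lemma tree_children_nspine T x i : uniq (labels T) -> x \in tree_children T i -> x \notin spine T.
Proof.
elim: T => // j L IHL R IHR uT; rewrite tree_childrenE //.
have [jL jR uL uR LR] := uniq_node uT.
have inL : x \in labels L -> x \notin spine (Node j L R).
  move=> xL; rewrite inE negb_or; apply/andP; split.
    by apply: contraNneq jL => <-.
  by apply: contra (LR _ xL) => /labels_split.
case: eqP => _; first by move/labels_split.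
case: ifP => _ xk; first exact: inL (tree_children_sub xk).
rewrite inE negb_or IHR // andbT; apply: contraNneq jR => <-; exact: tree_children_sub xk.
Qed.

Lemma tree_children_ex T x : uniq (labels T) -> x \in labels T -> x \notin spine T ->
  exists i, x \in tree_children T i.
Proof.
elim: T => // j L IHL R IHR uT; have [jL jR uL uR LR] := uniq_node uT.
rewrite /= !inE mem_cat negb_or; case: eqP => //= _ /orP[xL _|xR xs].
  case: (boolP (x \in spine L)) => [|xs]; first by exists j; rewrite eqxx.
  have [i xi] := IHL uL xL xs; exists i; rewrite ifN ?mem_cat ?xi //.
  by apply: contraNneq jL => ->; apply: tree_children_par xi.
have [i xi] := IHR uR xR xs; exists i; rewrite ifN ?mem_cat ?xi ?orbT //.
by apply: contraNneq jR => ->; apply: tree_children_par xi.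
Qed.

Lemma tree_children_inj T x i i' : uniq (labels T) ->
  x \in tree_children T i -> x \in tree_children T i' -> i = i'.
Proof.
elim: T => // j L IHL R IHR uT; have [jL jR uL uR LR] := uniq_node uT.
rewrite !tree_childrenE //.
case: (eqVneq j i) => [<-|_]; case: (eqVneq j i') => [<-|_] //.
- by case: ifP => _ xs xk; [have := tree_children_nspine uL xk; rewrite xs
    | have := LR _ (labels_split xs); rewrite (tree_children_sub xk)].
- by case: ifP => _ xk xs; [have := tree_children_nspine uL xk; rewrite xs
    | have := LR _ (labels_split xs); rewrite (tree_children_sub xk)].
case: ifP => _ xk; case: ifP => _ xk'; first exact: IHL.
- by have := LR _ (tree_children_sub xk); rewrite (tree_children_sub xk').
- by have := LR _ (tree_children_sub xk'); rewrite (tree_children_sub xk).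
exact: IHR.
Qed.

Lemma uniq_spine T : uniq (labels T) -> uniq (spine T).
Proof.
elim: T => // i L _ R IH /uniq_node[_ iR _ uR _] /=.
by rewrite IH // andbT; apply: contra iR => /labels_split.
Qed.

Lemma uniq_tree_children T i : uniq (labels T) -> uniq (tree_children T i).
Proof.
elim: T => // j L IHL R IHR uT; have [jL jR uL uR LR] := uniq_node uT.
by rewrite tree_childrenE //; case: eqP => _; [exact: uniq_spine | case: ifP; auto].
Qed.

(** * Trees built from child lists *)

Section Build.
Variables (n : nat) (K : 'I_n -> seq 'I_n).

(* Nesting is cut off at level d: K, a choice of child lists, need not be acyclic. *)
Fixpoint build d (s : seq 'I_n) : tree :=
  if d is d'.+1 then foldr (fun j : 'I_n => Node j (build d' (K j))) Leaf s else Leaf.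

Fixpoint vertices d (s : seq 'I_n) : seq 'I_n :=
  if d is d'.+1 then flatten [seq j :: vertices d' (K j) | j <- s] else [::].

Lemma labels_build d s : labels (build d s) = map val (vertices d s).
Proof.
elim: d s => //= d IH; elim=> //= j s IHs.
by rewrite map_cat IHs IH.
Qed.

Lemma spine_build d s : spine (build d.+1 s) = map val s.
Proof. by rewrite /=; elim: s => //= j s ->. Qed.

(** A tree is determined by its spine and child lists; it has at most as many levels as labels, so
    the cut-off at [d] does no harm. *)
Lemma build_tree_children d T s : uniq (labels T) -> size (labels T) <= d ->
  (forall x : 'I_n, val x \in labels T -> map val (K x) = tree_children T x) ->
  map val s = spine T -> build d s = T.
Proof.
elim: T d s => [|i L IHL R IHR] d s; first by case: s => //; case: d.
move=> uT; have [iL iR uL uR LR] := uniq_node uT.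
case: s => // j s; case: d => // d.
rewrite [labels _]/= [size _]/= size_cat ltnS => sz hK [ji es].
have sL : size (labels L) <= d by lia.
have sR : size (labels R) <= d.+1 by lia.
rewrite /= -/(build d.+1 s) ji; congr Node.
  apply: IHL => // [x xL|]; last by rewrite hK /= ?ji ?inE ?eqxx.
  rewrite hK /= ?inE ?mem_cat ?xL ?orbT // ifN; first by rewrite (tree_children_nil (LR _ xL)) cats0.
  by apply: contraNneq iL => ->.
apply: IHR => // x xR.
rewrite hK /= ?inE ?mem_cat ?xR ?orbT // ifN; last by apply: contraNneq iR => ->.
by rewrite (@tree_children_nil L) //; apply/negP => /LR; rewrite xR.
Qed.

End Build.

Lemma bigmin_lt (I : Type) a k (s : seq I) (P : pred I) (f : I -> nat) :
  (\big[minn/a]_(x <- s | P x) f x < k) = (a < k) || has (fun x => P x && (f x < k)) s.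
Proof.
elim: s => [|x s IH]; first by rewrite big_nil orbF.
rewrite big_cons /=; case: (P x) => //=.
by rewrite gtn_min IH orbCA.
Qed.

Lemma eq_from_ltn a b : (forall k, (a < k) = (b < k)) -> a = b.
Proof. by move=> h; apply/eqP; rewrite eqn_leq -(ltnS a) h ltnSn -(ltnS b) -h ltnSn. Qed.

Lemma map_index_uniq (A : eqType) (l : seq A) : uniq l ->
  map (index^~ l) l = iota 0 (size l).
Proof.
case: l => // x s ul; apply: (@eq_from_nth _ 0); rewrite size_map ?size_iota // => k lt.
by rewrite (nth_map x) // index_uniq // nth_iota.
Qed.

(** * The tree of a valid forest *)

Section Bridge.
Variables (n r : nat).
Hypothesis rn : r <= n.

Definition roots : seq 'I_n := [seq i <- enum 'I_n | isroot r i].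

Lemma val_roots : map val roots = iota 0 r.
Proof.
rewrite /roots -(filter_map val (fun i => i < r)) val_enum_ord.
exact: filter_iota_ltn.
Qed.

Lemma mem_roots i : (i \in roots) = isroot r i.
Proof. by rewrite mem_filter mem_enum andbT. Qed.

Definition position (F : pforest n) (j : 'I_n) : nat := F.2 j.

Definition children (F : pforest n) (i : 'I_n) : seq 'I_n :=
  sort (relpre (position F) leq) (enum [set k | ~~ isroot r k & F.1 k == i]).

(** Depths are at most n, so n + 1 levels contain every vertex. *)
Definition tree_of F := build (children F) n.+1 roots.

Lemma mem_children F i k : (k \in children F i) = ~~ isroot r k && (F.1 k == i).
Proof. by rewrite mem_sort mem_enum inE. Qed.

Lemma uniq_children F i : uniq (children F i).
Proof. by rewrite sort_uniq enum_uniq. Qed.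

Section Valid.
Variable F : pforest n.
Hypothesis vF : valid_forest r F.
Let g := F.1.
Let K := children F.

Lemma fix_root i : (g i == i) = isroot r i.
Proof. by case/and5P: vF => /forallP/(_ i)/eqP. Qed.

Lemma iter_root j : isroot r (iter n g j).
Proof. by case/and5P: vF => _ /forallP. Qed.

Lemma pos_root i : isroot r i -> F.2 i = i.
Proof. by case/and5P: vF => _ _ /forallP/(_ i)/implyP h _ _ /h/eqP. Qed.

Lemma pos_lt j : ~~ isroot r j -> F.2 j < size (K (g j)).
Proof.
case/and5P: vF => _ _ _ /forallP/(_ j)/implyP h _ /h.
by rewrite size_sort -cardE.
Qed.

Lemma pos_inj i : {in K i &, injective (position F)}.
Proof.
move=> j k; rewrite !mem_children => /andP[jr /eqP gj] /andP[kr /eqP gk] e.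
case/and5P: vF => _ _ _ _ /forallP/(_ j)/forallP/(_ k)/implyP h.
by apply/eqP/h; rewrite jr kr gj gk eqxx; apply/eqP/val_inj.
Qed.

Lemma sorted_children i : sorted ltn (map (position F) (K i)).
Proof.
rewrite ltn_sorted_uniq_leq map_inj_in_uniq ?uniq_children; last exact: pos_inj.
by rewrite sorted_map sort_sorted // => x y; apply: leq_total.
Qed.

(** The positions are distinct and below the number of children, so they fill the whole range. *)
Lemma map_position i : map (position F) (K i) = iota 0 (size (K i)).
Proof.
apply: (irr_sorted_eq ltn_trans ltnn (sorted_children i) (iota_ltn_sorted _ _)).
have u : uniq (map (position F) (K i)) by exact: (sorted_uniq ltn_trans ltnn (sorted_children i)).
have sub : {subset map (position F) (K i) <= iota 0 (size (K i))}.
  move=> x /mapP[j]; rewrite mem_iota mem_children => /andP[jr /eqP <-] ->.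
  exact: pos_lt.
by case: (uniq_min_size u sub); rewrite ?size_map ?size_iota.
Qed.

Lemma index_children j : ~~ isroot r j -> index j (K (g j)) = position F j.
Proof.
move=> jr; have jK : j \in K (g j) by rewrite mem_children jr eqxx.
have := congr1 (fun s => nth 0 s (index j (K (g j)))) (map_position (g j)).
by rewrite /= (nth_map j) ?index_mem // nth_index // nth_iota ?index_mem.
Qed.

Lemma iter_fix e i : isroot r i -> iter e g i = i.
Proof. by rewrite -fix_root => /eqP gi; elim: e => //= e ->. Qed.

(** The distance from [j] to its root: iterates of the parent map count until they reach a root,
    where they stay. *)
Definition depth j := \sum_(e < n) ~~ isroot r (iter e g j).

Lemma depth_root i : isroot r i -> depth i = 0.
Proof. by move=> ir; apply: big1 => e _; rewrite iter_fix // ir. Qed.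

Lemma depthS j : depth j = ~~ isroot r j + depth (g j).
Proof.
(* The additional term e = n vanishes, since the n-th iterate is a root. *)
transitivity (\sum_(e < n.+1) ~~ isroot r (iter e g j)).
  by rewrite big_ord_recr /= iter_root addn0.
by rewrite big_ord_recl /=; congr (_ + _); apply: eq_bigr => e _; rewrite -iterSr.
Qed.

Lemma depth_le j : depth j <= n.
Proof.
rewrite -[leqRHS]card_ord -sum1_card; apply: leq_sum => e _; exact: leq_b1.
Qed.

Lemma depth_iter e x : depth (iter e g x) = depth x - e.
Proof.
elim: e => [|e IH]; first by rewrite subn0.
rewrite iterS subnS -IH [depth (iter e g x)]depthS.
case: (boolP (isroot r (iter e g x))) => [ir|_] //=.
by rewrite add0n depth_root ?(eqP (etrans (fix_root _) ir)) //.
Qed.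

Lemma root_depth x : isroot r (iter (depth x) g x).
Proof.
have := depth_iter (depth x) x; rewrite subnn depthS.
by case: isroot.
Qed.

Lemma depth_children i k : k \in K i -> depth k = (depth i).+1.
Proof. by rewrite mem_children depthS => /andP[-> /eqP->]. Qed.

(** Reduces the recursive list to depths and a single ancestor: [iter (depth x - l) g x] is the
    ancestor of [x] on the level of [s]. *)
Lemma mem_vertices d l s x : {in s, forall j, depth j = l} ->
  (x \in vertices K d s) =
  (l <= depth x < l + d) && (iter (depth x - l) g x \in s).
Proof.
elim: d l s => [|d IH] l s hs; first by rewrite addn0 ltnNge; case: leqP.
rewrite [vertices _ _ _]/=; apply/flattenP/andP.
  move=> [_ /mapP[j js ->]]; rewrite inE => /orP[/eqP->|].
    by rewrite hs // subnn leqnn js addnS ltnS leq_addr.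
  rewrite (IH l.+1) => [|k /depth_children->]; last by rewrite hs.
  case/andP=> h; rewrite mem_children -iterS => /andP[_ /eqP e].
  by split; [lia | rewrite -subSn ?subSS in e; [rewrite e | lia]].
move=> [h js]; set j := iter _ g x in js.
exists (j :: vertices K d (K j)); first exact: (map_f (fun j => j :: vertices K d (K j))).
rewrite inE; case: (ltngtP l (depth x)) => [lt|gt|e]; last 2 first.
- lia.
- by rewrite /j e subnn eqxx.
rewrite orbC (IH l.+1) => [|k /depth_children->]; last by rewrite hs.
rewrite mem_children -iterS -subSn // subSS eqxx andbT.
rewrite (_ : l < _ < _); last by lia.
rewrite (_ : ~~ _) //; apply/negP => /depth_root; rewrite depth_iter; lia.
Qed.

Lemma vertices1 d j : vertices K d.+1 [:: j] = j :: vertices K d (K j).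
Proof. by rewrite /= cats0. Qed.

Lemma vertices_cons d j s :
  vertices K d.+1 (j :: s) = (j :: vertices K d (K j)) ++ vertices K d.+1 s.
Proof. by []. Qed.

(** The parts below different members of [s] are disjoint, as a vertex has only one ancestor at
    depth [l]. *)
Lemma uniq_vertices d l s : {in s, forall j, depth j = l} -> uniq s ->
  uniq (vertices K d s).
Proof.
elim: d l s => [//|d IH] l; elim=> [//|j s IHs] hs /= /andP[js us].
have hj : {in [:: j], forall k, depth k = l}.
  by move=> k; rewrite inE => /eqP->; apply: hs; rewrite mem_head.
have hs' : {in s, forall k, depth k = l} by move=> k ks; apply: hs; rewrite inE ks orbT.
have hK : {in K j, forall k, depth k = l.+1}.
  by move=> k /depth_children->; rewrite hs ?mem_head.
rewrite -/(vertices K d.+1 s) -[_ && _]/(uniq ((j :: vertices K d (K j)) ++ _)).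
rewrite cat_uniq IHs // andbT /= (IH l.+1) ?uniq_children // (mem_vertices _ _ hK).
rewrite hs ?mem_head // ltnn /=; apply/hasPn => x.
rewrite -/(vertices K d.+1 s) (mem_vertices d.+1 x hs') => /andP[_ xs].
have := mem_vertices d.+1 x hj; rewrite vertices1 => ->.
rewrite negb_and inE orbC; apply/orP; left.
by apply: contraNneq js => <-.
Qed.

Lemma roots_depth : {in roots, forall j, depth j = 0}.
Proof. by move=> j; rewrite mem_roots => /depth_root. Qed.

Lemma perm_vertices : perm_eq (vertices K n.+1 roots) (enum 'I_n).
Proof.
apply: uniq_perm; rewrite ?enum_uniq //.
  apply: uniq_vertices roots_depth _.
  by rewrite filter_uniq ?enum_uniq.
move=> x; rewrite (mem_vertices _ _ roots_depth) mem_enum mem_roots subn0 root_depth.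
by rewrite /= add0n ltnS depth_le.
Qed.

Lemma is_tree_of : is_tree r n (tree_of F).
Proof.
rewrite /is_tree spine_build val_roots eqxx andbT labels_build -val_enum_ord.
exact: perm_map perm_vertices.
Qed.

Lemma children_deep i : n <= depth i -> K i = [::].
Proof.
case e: (K i) => [//|k s] h; have := depth_le k.
by rewrite (@depth_children i) ?e ?mem_head //; lia.
Qed.

Lemma tree_children_build d l s x : {in s, forall j, depth j = l} -> uniq s -> n < d + l ->
  x \in vertices K d s -> tree_children (build K d s) x = map val (K x).
Proof.
elim: d l s => [//|d IH] l; elim=> [//|j s IHs] hs us fuel xs.
have hs' : {in s, forall k, depth k = l} by move=> k ks; apply: hs; rewrite inE ks orbT.
have hK : {in K j, forall k, depth k = l.+1}.
  by move=> k /depth_children->; rewrite hs ?mem_head.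
have := uniq_vertices d.+1 hs us; rewrite -(map_inj_uniq val_inj) -labels_build => uT.
have [jL jR uL uR LR] := uniq_node uT.
rewrite -[build K d.+1 (j :: s)]/(Node j (build K d (K j)) (build K d.+1 s)).
rewrite tree_childrenE //; case: eqP => [/val_inj<-|ne].
  (* If no level is left below [j], its depth is at least [n] and it has no children. *)
  case: d {IH IHs uT jL jR uL uR LR xs} fuel => [|d] fuel; last by rewrite spine_build.
  by rewrite children_deep // hs ?mem_head //; lia.
move: xs; rewrite vertices_cons mem_cat inE labels_build (mem_map val_inj).
rewrite (_ : (x == j) = false) /=; last by apply/eqP => e; apply: ne; rewrite e.
case: ifP => [xK _|_ /= xR]; first by apply: (IH l.+1); rewrite ?uniq_children //; lia.
by apply: IHs => //; case/andP: us.
Qed.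

Lemma tree_children_tree_of x : tree_children (tree_of F) (val x) = map val (K x).
Proof.
apply: tree_children_build roots_depth _ _ _; first by rewrite filter_uniq ?enum_uniq.
  by rewrite addn0.
by rewrite (perm_mem perm_vertices) mem_enum.
Qed.

(** Iterates of the parent map stay at a root once they reach it. As [j] is not a root, an iterate
    of [x] equal to [j] therefore takes exactly [depth x - depth j] steps. *)
Lemma mem_desc d j x : ~~ isroot r j -> n <= d + depth j ->
  (x \in vertices K d.+1 [:: j]) = desc F j x.
Proof.
move=> jr fuel; rewrite (@mem_vertices _ (depth j)); last by move=> k; rewrite inE => /eqP->.
have xn := depth_le x; rewrite inE; apply/andP/existsP => [[h e]|[e /eqP ej]].
  have h' : depth x - depth j < n.+1 by lia.
  by exists (Ordinal h').
have le : e <= depth x.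
  rewrite leqNgt; apply: contra jr => lt.
  by rewrite -ej -(subnK (ltnW lt)) iterD (iter_fix _ (root_depth x)) root_depth.
have dj : depth j = depth x - e by rewrite -ej depth_iter.
by rewrite (_ : depth x - depth j = e) ?dj ?ej ?eqxx; [split=> //; lia | lia].
Qed.

Lemma beta_lt j k : (beta F j < k) = (j < k) || [exists x, desc F j x && (x < k)].
Proof.
rewrite /beta bigmin_lt; congr (_ || _); apply/hasP/existsP => [[x _ h]|[x h]].
  by exists x.
by exists x => //; rewrite mem_index_enum.
Qed.

Lemma desc_refl j : desc F j j.
Proof. by apply/existsP; exists ord0. Qed.

Lemma has_vertices d j k : ~~ isroot r j -> n <= d + depth j ->
  has (fun x : 'I_n => x < k) (vertices K d.+1 [:: j]) = (beta F j < k).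
Proof.
move=> jr fuel; rewrite beta_lt; apply/hasP/orP => [[x]|[jk|/existsP[x /andP[jx xk]]]].
- by rewrite mem_desc // => jx xk; right; apply/existsP; exists x; rewrite jx.
- by exists j => //; rewrite mem_desc // desc_refl.
- by exists x => //; rewrite mem_desc.
Qed.

Lemma min_desc_build d j : ~~ isroot r j -> n <= d + depth j ->
  min_desc j (build K d (K j)) = beta F j.
Proof.
move=> jr fuel; apply: eq_from_ltn => k; rewrite min_desc_lt -(has_vertices _ jr fuel).
by rewrite vertices1 labels_build /= has_map.
Qed.

(** * The weight of the tree as a product over vertices *)

Section Weight.
Local Open Scope ring_scope.
Variables (A : comNzRingType) (t y : A).

Definition vweight j : A :=
  if elder r F j then t else if improper r F j then y else 1.

(** The decomposition of [K v] makes [s] the list of right brothers of [j], so a smaller label in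
    the tree built from [s] yields the brother required by [elder], and conversely. *)
Lemma node_weight_build d v p j s : K v = p ++ j :: s -> (n <= d + depth j)%N ->
  node_weight t y v j (build K d (K j)) (build K d.+1 s) = vweight j.
Proof.
move=> eK fuel.
have jv : j \in K v by rewrite eK mem_cat mem_head orbT.
have dj := depth_children jv.
have [jr /eqP gj] : ~~ isroot r j /\ g j == v by move: jv; rewrite mem_children => /andP.
have sK k : k \in s -> k \in K v by rewrite eK mem_cat inE => ->; rewrite !orbT.
(* Child lists increase strictly in position, so the entries after [j] are those of larger
   position. *)
have mem_s k : (k \in s) = (k \in K v) && (position F j < position F k)%N.
  have := sorted_children v; rewrite eK sorted_map.
  rewrite (sorted_pairwise (fun a b c => @ltn_trans _ _ _)) pairwise_cat /=.
  case/and3P => /allrelP ps _ /andP[/allP js _].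
  rewrite mem_cat inE; apply/idP/idP => [ks|]; first by rewrite ks !orbT js.
  case/andP=> /or3P[kp|/eqP->|//]; last by rewrite ltnn.
  by have := ps _ _ kp (mem_head j s) => /= ?; lia.
have eE : elder_node j (build K d (K j)) (build K d.+1 s) = elder r F j.
  rewrite /elder_node min_desc_build // labels_build has_map /elder jr /=.
  apply/hasP/existsP => [[x]|[k]].
    move=> /flattenP[_ /mapP[k ks ->] xk] /= xb; exists k.
    have kK := sK _ ks; have dk := depth_children kK.
    move: (kK); rewrite mem_children => /andP[kr /eqP gk].
    move: ks; rewrite mem_s => /andP[_ lt].
    rewrite kr [F.1 k]gk [F.1 j]gj eqxx lt /=; apply/andP; split.
      by apply: contraTneq lt => ->; rewrite ltnn.
    rewrite -(@has_vertices d) ?kr //; last by rewrite dk -dj.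
    by apply/hasP; exists x => //; rewrite vertices1.
  case/and5P=> kr _ /eqP gk lt bk.
  have kK : k \in K v by rewrite mem_children kr gk gj eqxx.
  have dk := depth_children kK.
  move: bk; rewrite -(@has_vertices d) ?dk -?dj // => /hasP[x xk xb].
  exists x => //; apply/flattenP; exists (k :: vertices K d (K k)); last by rewrite -vertices1.
  by apply: (map_f (fun j => j :: vertices K d (K j))); rewrite mem_s kK.
rewrite /node_weight /vweight eE min_desc_build // /improper; case: elder => //=.
(* It remains to exclude that [v] is the least descendant of its own child [j]; the depths forbid
   it. *)
rewrite jr /= [F.1 j]gj -leqNgt ltn_neqAle (_ : (_ != _) = true) //.
apply/negP => /eqP e; have := min_desc_mem j (build K d (K j)).
rewrite min_desc_build // e labels_build -map_cons -vertices1 (mem_map val_inj).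
rewrite (@mem_vertices _ (depth j)); last by move=> k; rewrite inE => /eqP->.
by rewrite dj ltnn.
Qed.

(** Stated for a final segment [s] of a child list, so that the induction can pass from a vertex to
    its right brothers. *)
Lemma weight_build d v p s : K v = p ++ s -> (n <= d + depth v)%N ->
  weight t y v (build K d s) = \prod_(x <- vertices K d s) vweight x.
Proof.
elim: d v p s => [|d IH] v p s; first by rewrite big_nil.
elim: s p => [|j s IHs] p eK fuel; first by rewrite big_nil.
have dj : depth j = (depth v).+1 by apply: depth_children; rewrite eK mem_cat mem_head orbT.
have fj : (n <= d + depth j)%N by lia.
rewrite -[build K d.+1 (j :: s)]/(Node j (build K d (K j)) (build K d.+1 s)).
rewrite vertices_cons big_cat big_cons /= (node_weight_build eK fj).
rewrite (IH j [::]) // -/(build K d.+1 s) (IHs (rcons p j)) //.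
by rewrite eK cat_rcons.
Qed.

Lemma forest_weight_tree_of : forest_weight t y (tree_of F) = \prod_j vweight j.
Proof.
rewrite -big_enum /= -(perm_big _ perm_vertices) /tree_of -/K.
have : all (isroot r) roots by rewrite filter_all.
elim: (roots) => [_|j s IHs /andP[jr sr]]; first by rewrite /= big_nil.
rewrite -[build K n.+1 (j :: s)]/(Node j (build K n (K j)) (build K n.+1 s)).
rewrite vertices_cons big_cat big_cons -IHs //=.
rewrite -(@weight_build n j [::]) ?leq_addr // /vweight /elder /improper /elder jr /=.
by rewrite mul1r.
Qed.

Lemma prod_vweight : \prod_j vweight j = t ^+ eld r F * y ^+ n_improper r F.
Proof.
rewrite /eld /n_improper -!prodr_const !(big_mkcond (fun i => i \in _)) /= -big_split /=.
apply: eq_bigr => j _; rewrite !inE /vweight /improper; case: elder => /=.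
  by rewrite andbF mulr1.
by rewrite mul1r.
Qed.

End Weight.
End Valid.
End Bridge.

(** * The bijection between valid forests and trees *)

Section Bijection.
Variables (n r : nat).
Hypothesis rn : r <= n.

(** The tree determines all child lists; membership in them gives the parents, and the index in them
    gives the positions. *)
Lemma tree_of_inj : {in [pred F : pforest n | valid_forest r F] &,
  injective (tree_of r)}.
Proof.
move=> F F' vF vF' e.
have eK x : children r F x = children r F' x.
  apply: (inj_map val_inj); rewrite -(tree_children_tree_of rn vF) -(tree_children_tree_of rn vF').
  by rewrite e.
have eg j : F'.1 j = F.1 j.
  case: (boolP (isroot r j)) => jr.
    by move: (jr) (jr); rewrite -{1}(fix_root vF) -(fix_root vF') => /eqP-> /eqP->.
  have : j \in children r F (F.1 j) by rewrite mem_children jr /=.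
  by rewrite eK mem_children => /andP[_ /eqP].
have ep j : F'.2 j = F.2 j.
  case: (boolP (isroot r j)) => jr; first by rewrite !(@pos_root n r).
  apply: val_inj; rewrite -[LHS]/(position F' j) -[RHS]/(position F j).
  by rewrite -(index_children vF jr) -(index_children vF' jr) eg eK.
case: F F' eg ep {vF vF' e eK} => [g p] [g' p'] /= eg ep.
by congr pair; apply/ffunP.
Qed.

Section Forest.
Variable T : tree.
Hypothesis tT : is_tree r n T.

Let uT : uniq (labels T) := is_tree_uniq tT.

Lemma mem_spine (x : 'I_n) : (val x \in spine T) = isroot r x.
Proof. by case/andP: tT => _ /eqP->; rewrite mem_iota. Qed.

Lemma mem_labels (x : 'I_n) : val x \in labels T.
Proof. by rewrite (is_tree_lt _ tT) ltn_ord. Qed.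

(** A root occurs in no child list, so the default makes it a fixed point, as [valid_forest]
    demands. *)
Definition tree_parent : {ffun 'I_n -> 'I_n} :=
  [ffun x => odflt x [pick i : 'I_n | val x \in tree_children T i]].

(** For a non-root the index is below [n] by [size_tree_children], so [insubd] returns it and not
    the default [x]. *)
Definition forest_of : pforest n :=
  (tree_parent,
   [ffun x => if isroot r x then x
              else insubd x (index (val x) (tree_children T (tree_parent x)))]).

Lemma tree_parentE (x : 'I_n) i : val x \in tree_children T i -> val (tree_parent x) = i.
Proof.
move=> xi; rewrite ffunE; case: pickP => [k xk|/= h].
  exact: tree_children_inj uT xk xi.
have := tree_children_par xi; rewrite (is_tree_lt _ tT) => lt.
by have := h (Ordinal lt); rewrite /= xi.
Qed.

Lemma tree_parent_root (x : 'I_n) : isroot r x -> tree_parent x = x.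
Proof.
rewrite ffunE -mem_spine; case: pickP => // k xk.
by rewrite (negbTE (tree_children_nspine uT xk)).
Qed.

Lemma mem_tree_children_parent (x i : 'I_n) :
  (val x \in tree_children T i) = ~~ isroot r x && (tree_parent x == i).
Proof.
apply/idP/andP => [xi|[xr /eqP <-]].
  rewrite -mem_spine (tree_children_nspine uT xi); split=> //.
  by apply/eqP/val_inj/tree_parentE.
have [k xk] : exists k, val x \in tree_children T k.
  by apply: tree_children_ex; rewrite ?mem_spine ?mem_labels.
by rewrite (tree_parentE xk).
Qed.

(** From inside [L] the walk upwards reaches the spine of [L], and one more step leads to [j]. The
    bound on [e] ensures that n steps suffice in the whole tree. *)
Lemma parent_reaches_spine (X : tree) (x : 'I_n) : uniq (labels X) ->
  (forall (z : 'I_n) i, val z \in tree_children X i -> val (tree_parent z) = i) ->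
  val x \in labels X ->
  exists2 e, e < size (labels X) & val (iter e tree_parent x) \in spine X.
Proof.
elim: X x => // j L IHL R IHR x uX hX; have [jL jR uL uR LR] := uniq_node uX.
have hL (z : 'I_n) i : val z \in tree_children L i -> val (tree_parent z) = i.
  move=> zi; apply: hX; rewrite tree_childrenE // (tree_children_par zi) ifN //.
  by apply: contraNneq jL => ->; apply: tree_children_par zi.
have hR (z : 'I_n) i : val z \in tree_children R i -> val (tree_parent z) = i.
  move=> zi; apply: hX; rewrite /= ifN ?mem_cat ?zi ?orbT //.
  by apply: contraNneq jR => ->; apply: tree_children_par zi.
rewrite /= inE mem_cat size_cat => /or3P[xj|xL|xR].
- by exists 0; rewrite // inE xj.
- have [e lt es] := IHL x uL hL xL; exists e.+1; first by lia.
  by rewrite iterS (hX _ j) ?mem_head //= eqxx.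
- have [e lt es] := IHR x uR hR xR; exists e; first by lia.
  by rewrite inE es orbT.
Qed.

Lemma tree_acyclic x : isroot r (iter n tree_parent x).
Proof.
have h (z : 'I_n) i : val z \in tree_children T i -> val (tree_parent z) = i by apply: tree_parentE.
have [e lt] := parent_reaches_spine uT h (mem_labels x).
rewrite mem_spine => er; have le : e <= n.
  case/andP: tT => /perm_size; rewrite size_iota => sz _; rewrite -sz; exact: ltnW.
rewrite (_ : iter n _ x = iter (n - e) tree_parent (iter e tree_parent x)); last first.
  by rewrite -iterD subnK.
elim: (n - e) => /= [|k IH]; first exact: er.
by rewrite tree_parent_root.
Qed.

Lemma tree_children_ord i : exists2 s : seq 'I_n, map val s = tree_children T i & uniq s.
Proof.
have h : all (fun x => x < n) (tree_children T i).
  by apply/allP => x /tree_children_sub; rewrite (is_tree_lt _ tT).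
exists (pmap insub (tree_children T i)); last by rewrite pmap_sub_uniq // uniq_tree_children.
rewrite pmap_filter; last exact: insubK.
by apply/all_filterP; apply: sub_all h => x lt; rewrite insubT.
Qed.

Lemma size_tree_children i : size (tree_children T i) <= n.
Proof.
have [s <- us] := tree_children_ord i.
by rewrite size_map -(card_uniqP us) -[leqRHS]card_ord max_card.
Qed.

Lemma position_forest (x i : 'I_n) : val x \in tree_children T i ->
  position forest_of x = index (val x) (tree_children T i).
Proof.
move=> xi; rewrite /position /= ffunE.
move: (xi); rewrite mem_tree_children_parent => /andP[/negbTE-> /eqP->].
by rewrite val_insubd (leq_trans _ (size_tree_children i)) ?index_mem.
Qed.

Lemma sibs_tree_children (s : seq 'I_n) (j : 'I_n) :
  map val s = tree_children T (tree_parent j) -> sibs r forest_of j =i s.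
Proof.
by move=> es k; rewrite inE /= -mem_tree_children_parent -es (mem_map val_inj).
Qed.

Lemma valid_forest_of : valid_forest r forest_of.
Proof.
apply/and5P; split; apply/forallP => j.
- apply/eqP; apply/eqP/idP => [e|/tree_parent_root->//].
  (* A fixed point equals its n-th iterate, which is a root. *)
  have it k : iter k tree_parent j = j by elim: k => //= k ->.
  by rewrite -(it n) tree_acyclic.
- exact: tree_acyclic.
- by apply/implyP => jr; rewrite ffunE jr.
- apply/implyP => jr; have jk : val j \in tree_children T (tree_parent j).
    by rewrite mem_tree_children_parent jr eqxx.
  have [s es us] := tree_children_ord (tree_parent j).
  rewrite (eq_card (sibs_tree_children es)) (card_uniqP us).
  rewrite -[nat_of_ord _]/(position forest_of j) (position_forest jk).
  by rewrite -(size_map val) es index_mem.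
apply/forallP => k; apply/implyP => /and4P[jr kr /eqP gjk /eqP pjk].
have jk : val j \in tree_children T (tree_parent j) by rewrite mem_tree_children_parent jr eqxx.
have kk : val k \in tree_children T (tree_parent j) by rewrite mem_tree_children_parent kr gjk eqxx.
have : position forest_of j = position forest_of k by rewrite /position pjk.
rewrite (position_forest jk) (position_forest kk) => e.
by apply/eqP/val_inj; rewrite -(nth_index 0 jk) e nth_index.
Qed.

(** Both lists have the same members and increase strictly in position, hence they coincide. *)
Lemma children_forest i : map val (children r forest_of i) = tree_children T i.
Proof.
have [s es us] := tree_children_ord i; rewrite -es; congr map.
apply: (@irr_sorted_eq _ (relpre (position forest_of) ltn)).
- by move=> a b c; apply: ltn_trans.
- by move=> a; apply: ltnn.
- by rewrite -sorted_map; apply: sorted_children valid_forest_of _.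
- rewrite -sorted_map.
  have -> : map (position forest_of) s = map (index^~ (tree_children T i)) (tree_children T i).
    rewrite -{2}es -map_comp; apply/eq_in_map => x xs.
    by rewrite (position_forest (i := i)) //= -es map_f.
  by rewrite map_index_uniq ?uniq_tree_children // iota_ltn_sorted.
by move=> k; rewrite mem_children -mem_tree_children_parent -es (mem_map val_inj).
Qed.

Lemma forest_ofK : tree_of r forest_of = T.
Proof.
have [pT /eqP sT] := andP tT.
apply: build_tree_children => // [|x _|]; last by rewrite val_roots.
  by rewrite (perm_size pT) size_iota.
exact: children_forest.
Qed.

End Forest.

Lemma perm_trees :
  perm_eq [seq tree_of r F | F <- enum [pred F : pforest n | valid_forest r F]]
          (trees r (n - r)).
Proof.
apply: uniq_perm; last 2 first.
- exact: uniq_trees.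
- move=> T; rewrite mem_trees subnKC //; apply/mapP/idP => [[F]|tT].
    by rewrite mem_enum => vF ->; apply: is_tree_of.
  exists (forest_of T); last by rewrite forest_ofK.
  by rewrite mem_enum; apply: valid_forest_of.
rewrite map_inj_in_uniq ?enum_uniq // => F F'.
by rewrite !mem_enum; apply: tree_of_inj.
Qed.

Local Open Scope ring_scope.

Lemma sum_forests :
  \sum_(F : pforest n | valid_forest r F) ('X)%:P ^+ eld r F * 'X ^+ n_improper r F
  = tree_sum r (n - r).
Proof.
rewrite /tree_sum -(perm_big _ perm_trees) big_map big_enum.
by apply: eq_bigr => F vF; rewrite -prod_vweight -(forest_weight_tree_of rn).
Qed.

End Bijection.

(** * Extraction of the coefficient of y^k *)

Local Open Scope ring_scope.

Theorem theorem5p1 (r n k : nat) :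
  (1 <= r)%N -> (r.+1 <= n)%N ->
  r%:R * Qmk (n - r) k r =
  \sum_(F : pforest n | valid_forest r F && (n_improper r F == k))
     'X^(eld r F) :> {poly int}.
Proof.
move=> _ rn.
have e : (n - r = (n - r).-1.+1)%N by lia.
transitivity ((tree_sum r (n - r))`_k).
  by rewrite e tree_sumE -e !mulr_natl coefMn.
(* The outer variable marks improper edges, so its k-th coefficient keeps the forests with exactly k
   of them. *)
rewrite -sum_forests ?(ltnW rn) // coef_sum [RHS]big_mkcondr /=.
apply: eq_bigr => F _; rewrite -polyC_exp coefCM coefXn eq_sym.
by case: eqP; rewrite ?mulr1 ?mulr0.
Qed.
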